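(* Let $(M^n,g,f)$ be a closed generalized $(\lambda,n+m)$-Einstein manifold with $\min_M f<0<\max_M f$ (so $f^{-1}(0)\neq\emptyset$). Then any connected component of $f^{-1}(0)$ is a totally geodesic hypersurface in $M$.
   Context: A closed generalized $(\lambda,n+m)$-Einstein manifold is a triple $(M^n,g,f)$ where $(M^n,g)$ is a closed (compact, connected, without boundary) Riemannian manifold of dimension $n\ge2$, $f$ is a smooth real function on $M$, and $Ddf=\frac{f}{m}(\mathrm{Ric}-\lambda g)$, where $Ddf$ is the Hessian of $f$, $\mathrm{Ric}$ is the Ricci tensor of $g$, $\lambda$ is a smooth function on $M$ and $m$ is a positive real number. *)

(* Defs.v *)
From HB Require Import structures.
From mathcomp Require Import all_boot all_order all_algebra.
From mathcomp Require Import all_classical all_reals all_analysis.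

Set Implicit Arguments.
Unset Strict Implicit.
Unset Printing Implicit Defensive.

Import Order.TTheory GRing.Theory Num.Theory numFieldNormedType.Exports.

Local Open Scope classical_set_scope.
Local Open Scope ring_scope.

Definition partial (R : realType) (n : nat) (i : 'I_n) (h : 'rV[R]_n -> R)
  : 'rV[R]_n -> R := fun x => 'D_'e_i h x.

(* Meant for open [U]: all iterated partial derivatives of order at most [k]
   exist and are continuous on [U]. *)
Fixpoint Ck (R : realType) (n k : nat) (U : set 'rV[R]_n) (h : 'rV[R]_n -> R)
  : Prop :=
  (forall x, U x -> {for x, continuous h}) /\
  (if k is k'.+1 then
     forall i : 'I_n,
       (forall x, U x -> derivable h x 'e_i) /\ Ck k' U (partial i h)
   else True).

Definition Csmooth (R : realType) (n : nat) (U : set 'rV[R]_n)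
  (h : 'rV[R]_n -> R) : Prop := forall k, Ck k U h.

(* The maps are total for convenience: [chart_fun] is only meaningful on
   [chart_dom] and [chart_inv] only on the image of [chart_dom]. *)
Record chart (R : realType) (n : nat) (M : topologicalType) := Chart {
  chart_dom : set M;
  chart_fun :> M -> 'rV[R]_n;
  chart_inv : 'rV[R]_n -> M;
  chart_dom_open : open chart_dom;
  chart_img_open : open (chart_fun @` chart_dom);
  chart_funK : forall p, chart_dom p -> chart_inv (chart_fun p) = p;
  chart_fun_cont : forall p, chart_dom p -> {for p, continuous chart_fun};
  chart_inv_cont : forall x, (chart_fun @` chart_dom) x ->
    {for x, continuous chart_inv}
}.

Definition chart_img (R : realType) (n : nat) (M : topologicalType)
  (c : chart R n M) : set 'rV[R]_n := c @` chart_dom c.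

Definition transition (R : realType) (n : nat) (M : topologicalType)
  (c d : chart R n M) : 'rV[R]_n -> 'rV[R]_n := fun x => d (chart_inv c x).

Definition smooth_transition (R : realType) (n : nat) (M : topologicalType)
  (c d : chart R n M) : Prop :=
  forall k : 'I_n, Csmooth (c @` (chart_dom c `&` chart_dom d))
    (fun x => transition c d x 0 k).

Definition compatible (R : realType) (n : nat) (M : topologicalType)
  (c d : chart R n M) : Prop := smooth_transition c d /\ smooth_transition d c.

(* A maximal smooth atlas; charts take values in open subsets of R^n, so there
   is no boundary. *)
Record smoothStructure (R : realType) (n : nat) (M : topologicalType) :=
  SmoothStructure {
    atlas : set (chart R n M);
    atlas_cover : forall p, exists2 c, atlas c & chart_dom c p;
    atlas_compatible : forall c d, atlas c -> atlas d -> compatible c d;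
    atlas_maximal : forall c, (forall d, atlas d -> compatible c d) -> atlas c
  }.

(* Second countability is automatic here: a compact space covered by charts is
   covered by finitely many second countable open sets. *)
Definition closed_manifold_space (M : topologicalType) : Prop :=
  [/\ hausdorff_space M, compact [set: M] & connected [set: M]].

Definition smooth_function (R : realType) (n : nat) (M : topologicalType)
  (A : smoothStructure R n M) (h : M -> R) : Prop :=
  forall c, atlas A c -> Csmooth (chart_img c) (h \o chart_inv c).

(* [transition_jacobian c d x i k] is d y^k / d x^i, where x are the
   coordinates of [c] and y those of [d]. *)
Definition transition_jacobian (R : realType) (n : nat) (M : topologicalType)
  (c d : chart R n M) (x : 'rV[R]_n) : 'M[R]_n :=
  \matrix_(i, k) partial i (fun z => transition c d z 0 k) x.

(* [metric c x i j] is the component g_ij of the metric, in the chart [c] at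
   the point of coordinates [x]; [metric_tensor] is the change of coordinates
   rule for (0,2)-tensors. *)
Record riemannianMetric (R : realType) (n : nat) (M : topologicalType)
  (A : smoothStructure R n M) := RiemannianMetric {
    metric :> chart R n M -> 'rV[R]_n -> 'M[R]_n;
    metric_smooth : forall c, atlas A c -> forall i j : 'I_n,
      Csmooth (chart_img c) (fun x => metric c x i j);
    metric_sym : forall c, atlas A c -> forall x, chart_img c x ->
      (metric c x)^T = metric c x;
    metric_pos : forall c, atlas A c -> forall x, chart_img c x ->
      forall v : 'rV[R]_n, v != 0 -> 0 < (v *m metric c x *m v^T) 0 0;
    metric_tensor : forall c d, atlas A c -> atlas A d ->
      forall p, chart_dom c p -> chart_dom d p ->
      metric c (c p) =
        transition_jacobian c d (c p) *m metric d (d p) *m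
        (transition_jacobian c d (c p))^T
  }.

(* Local formulas, for a metric [G] = (g_ij) on an open subset of R^n. *)

(* Gamma^k_ij, so that nabla_{d_i} d_j = sum_k Gamma^k_ij d_k. *)
Definition christoffel (R : realType) (n : nat) (G : 'rV[R]_n -> 'M[R]_n)
  (k i j : 'I_n) : 'rV[R]_n -> R := fun x =>
  2^-1 * \sum_(l < n) invmx (G x) k l *
    (partial i (fun z => G z j l) x + partial j (fun z => G z i l) x
     - partial l (fun z => G z i j) x).

(* Ddh(d_i, d_j) = d_i d_j h - (nabla_{d_i} d_j) h. *)
Definition hessian (R : realType) (n : nat) (G : 'rV[R]_n -> 'M[R]_n)
  (h : 'rV[R]_n -> R) (i j : 'I_n) : 'rV[R]_n -> R := fun x =>
  partial i (partial j h) x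
  - \sum_(k < n) christoffel G k i j x * partial k h x.

(* d_l-component of
   R(d_k, d_i) d_j = nabla_{d_k} nabla_{d_i} d_j - nabla_{d_i} nabla_{d_k} d_j. *)
Definition riemann (R : realType) (n : nat) (G : 'rV[R]_n -> 'M[R]_n)
  (l k i j : 'I_n) : 'rV[R]_n -> R := fun x =>
  partial k (christoffel G l i j) x - partial i (christoffel G l k j) x
  + \sum_(s < n) (christoffel G l k s x * christoffel G s i j x
                  - christoffel G l i s x * christoffel G s k j x).

(* Ric(Y, Z) = trace of X |-> R(X, Y) Z; positive on round spheres. *)
Definition ricci (R : realType) (n : nat) (G : 'rV[R]_n -> 'M[R]_n)
  (i j : 'I_n) : 'rV[R]_n -> R := fun x => \sum_(k < n) riemann G k k i j x.

(* Unit normal of the slice x^a = 0: the normalized gradient of x^a. *)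
Definition slice_normal (R : realType) (n : nat) (G : 'rV[R]_n -> 'M[R]_n)
  (a : 'I_n) (x : 'rV[R]_n) : 'rV[R]_n :=
  (Num.sqrt (invmx (G x) a a))^-1 *: row a (invmx (G x)).

(* Second fundamental form g(nabla_{d_i} d_j, nu) of the slice x^a = 0, whose
   tangent space is spanned by the d_i with i != a. *)
Definition second_fundamental_form (R : realType) (n : nat)
  (G : 'rV[R]_n -> 'M[R]_n) (a i j : 'I_n) : 'rV[R]_n -> R := fun x =>
  \sum_(k < n) \sum_(l < n)
    christoffel G k i j x * G x k l * slice_normal G a x 0 l.

Definition generalized_Einstein (R : realType) (n : nat) (M : topologicalType)
  (A : smoothStructure R n M) (g : riemannianMetric A) (f : M -> R)
  (lambda : M -> R) (m : R) : Prop :=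
  [/\ smooth_function A f, smooth_function A lambda, 0 < m &
    forall c, atlas A c -> forall x, chart_img c x -> forall i j : 'I_n,
      hessian (g c) (f \o chart_inv c) i j x =
        f (chart_inv c x) / m *
        (ricci (g c) i j x - lambda (chart_inv c x) * g c x i j)].

Definition slice_chart (R : realType) (n : nat) (M : topologicalType)
  (A : smoothStructure R n M) (N : set M) (c : chart R n M) (a : 'I_n)
  : Prop :=
  atlas A c /\ forall q, chart_dom c q -> (N q <-> c q 0 a = 0).

(* Embedded submanifold of codimension one. *)
Definition hypersurface (R : realType) (n : nat) (M : topologicalType)
  (A : smoothStructure R n M) (N : set M) : Prop :=
  forall p, N p ->
    exists (c : chart R n M) (a : 'I_n), slice_chart A N c a /\ chart_dom c p.

Definition totally_geodesic (R : realType) (n : nat) (M : topologicalType)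
  (A : smoothStructure R n M) (g : riemannianMetric A) (N : set M) : Prop :=
  forall (c : chart R n M) (a : 'I_n), slice_chart A N c a ->
  forall p, N p -> chart_dom c p ->
  forall i j : 'I_n, i != a -> j != a ->
    second_fundamental_form (g c) a i j (c p) = 0.

(* Main.v *)
Require Import Defs.
From HB Require Import structures.
From mathcomp Require Import all_boot all_order all_algebra.
From mathcomp Require Import ring lra.
From mathcomp Require Import all_classical all_reals all_analysis.

Set Implicit Arguments.
Unset Strict Implicit.
Unset Printing Implicit Defensive.

Import Order.TTheory GRing.Theory Num.Theory numFieldNormedType.Exports.

Local Open Scope classical_set_scope.
Local Open Scope ring_scope.

(** If [f] and [df] both vanish at a point, the equation
    [Ddf = (f / m) (Ric - lambda g)] bounds the second derivatives of [f] by its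
    1-jet, so Gronwall's inequality along coordinate lines makes [f] vanish near
    that point. The interior of [f^-1(0)] is therefore open and closed, hence
    empty since [f] takes nonzero values, and [df <> 0] on [f^-1(0)].
    Consequently [f] can replace a coordinate of a chart, which straightens
    [f^-1(0)]. On a slice [x^a = 0] of [f^-1(0)] the Hessian of [f] vanishes, as do
    [d_i d_j f] and [d_k f] for [i, j, k <> a]; what is left is
    [Gamma^a_ij d_a f = 0], and [Gamma^a_ij] is the second fundamental form up to
    a factor. *)

(** * Locality of limits on open sets *)

Section LocalEquality.
Context {T T' : topologicalType}.
Implicit Types (U : set T) (h : T -> T').

Lemma near_open U x (P : T -> Prop) : open U -> U x ->
  (forall y, U y -> P y) -> \forall y \near x, P y.
Proof. by move=> oU Ux UP; apply: filterS UP _; exact: open_nbhs_nbhs. Qed.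

Lemma eq_continuous_at U h1 h2 x : open U -> U x ->
  (forall y, U y -> h1 y = h2 y) ->
  {for x, continuous h1} -> {for x, continuous h2}.
Proof.
move=> oU Ux e12; rewrite /prop_for /continuous_at -e12//.
by apply: cvg_trans; apply: (@near_eq_cvg _ _ (nbhs x)); exact: (near_open oU Ux).
Qed.

End LocalEquality.

(** * Closure properties of the classes [Ck] *)

Section CkAlgebra.
Context {R : realType} {n : nat}.
Implicit Types (U V : set 'rV[R]_n) (h : 'rV[R]_n -> R).

Lemma Ck_continuous k U h : Ck k U h -> forall x, U x -> {for x, continuous h}.
Proof. by case: k => [|k] []. Qed.

Lemma CkS_derivable k U h i x : Ck k.+1 U h -> U x -> derivable h x 'e_i.
Proof. by move=> [_ /(_ i)[+ _]] Ux; apply. Qed.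

Lemma CkS_partial k U h i : Ck k.+1 U h -> Ck k U (partial i h).
Proof. by move=> [_ /(_ i)[]]. Qed.

Lemma Csmooth_partial U h i : Csmooth U h -> Csmooth U (partial i h).
Proof. by move=> hs k; exact: CkS_partial (hs k.+1). Qed.

(** Derivatives are local and [U] is open, so agreement on [U] passes to every order; computed
    formulas can thus replace derivatives below. *)
Lemma Ck_eq k U h1 h2 : open U -> (forall x, U x -> h1 x = h2 x) ->
  Ck k U h1 -> Ck k U h2.
Proof.
move=> oU; elim: k h1 h2 => [|k IH] h1 h2 e12 [c1 d1].
  split=> // x Ux; exact: (eq_continuous_at oU Ux e12 (c1 x Ux)).
split=> [x Ux|i]; first exact: (eq_continuous_at oU Ux e12 (c1 x Ux)).
have [d c] := d1 i; split=> [x Ux|].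
  by apply: near_eq_derivable (d x Ux); exact: (near_open oU Ux).
apply: IH c => x Ux; rewrite /partial; apply: near_eq_derive.
exact: (near_open oU Ux).
Qed.

Lemma Ck_subset k U V h : V `<=` U -> Ck k U h -> Ck k V h.
Proof.
move=> VU; elim: k h => [|k IH] h [c d]; split=> //.
- by move=> x /VU; exact: c.
- by move=> x /VU; exact: c.
- move=> i; have [d1 d2] := d i; split; last exact: IH.
  by move=> x /VU; exact: d1.
Qed.

Lemma CkS k U h : Ck k.+1 U h -> Ck k U h.
Proof.
elim: k h => [|k IH] h [c d]; split=> // i.
by have [d1 /IH d2] := d i.
Qed.

Lemma Ck_cst k U c : Ck k U (fun=> c).
Proof.
elim: k c => [|k IH] c; split=> //; try by move=> x _; exact: cst_continuous.
move=> i; split=> [x _|]; first exact: derivable_cst.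
have -> // : partial i (fun=> c) = fun=> 0.
by apply/funext => x; rewrite /partial derive_cst.
Qed.

Lemma CkD k U h1 h2 : open U -> Ck k U h1 -> Ck k U h2 ->
  Ck k U (fun x => h1 x + h2 x).
Proof.
move=> oU; elim: k h1 h2 => [|k IH] h1 h2 [c1 d1] [c2 d2]; split=> //;
  try by move=> x Ux; apply: continuousD; [exact: c1|exact: c2].
move=> i; have [d11 d12] := d1 i; have [d21 d22] := d2 i; split=> [x Ux|].
  by apply: derivableD; [exact: d11|exact: d21].
apply: Ck_eq (IH _ _ d12 d22) => // x Ux.
by rewrite /partial deriveD; [|exact: d11|exact: d21].
Qed.

Lemma CkM k U h1 h2 : open U -> Ck k U h1 -> Ck k U h2 ->
  Ck k U (fun x => h1 x * h2 x).
Proof.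
move=> oU; elim: k h1 h2 => [|k IH] h1 h2 C1 C2.
  case: (C1) (C2) => [c1 d1] [c2 d2]; split=> // x Ux.
  by apply: continuousM; [exact: c1|exact: c2].
case: (C1) (C2) => [c1 d1] [c2 d2]; split=> [x Ux|i].
  by apply: continuousM; [exact: c1|exact: c2].
have [d11 d12] := d1 i; have [d21 d22] := d2 i; split=> [x Ux|].
  by apply: derivableM; [exact: d11|exact: d21].
have := CkD oU (IH _ _ (CkS C1) d22) (IH _ _ (CkS C2) d12).
apply: Ck_eq => // x Ux.
by rewrite /partial deriveM; [|exact: d11|exact: d21].
Qed.

(** By induction on the order, since the derivative [- h^-2 h'] involves [h^-1] one order lower. *)
Lemma CkV k U h : open U -> (forall x, U x -> h x != 0) -> Ck k U h ->
  Ck k U (fun x => (h x)^-1).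
Proof.
move=> oU h0; elim: k => [|k IH] C; case: (C) => c d.
  by split=> // x Ux; apply: continuousV; [exact: h0|exact: c].
split=> [x Ux|i]; first by apply: continuousV; [exact: h0|exact: c].
have [d1 d2] := d i; split=> [x Ux|].
  by apply: derivableV; [exact: h0|exact: d1].
have Ch := IH (CkS C).
have := CkM oU (CkM oU (Ck_cst k U (-1)) (CkM oU Ch Ch)) d2.
apply: Ck_eq => // x Ux; rewrite /partial deriveV; [|exact: h0|exact: d1].
by rewrite expr2 invfM mulN1r.
Qed.

Lemma CkN k U h : open U -> Ck k U h -> Ck k U (fun x => - h x).
Proof.
move=> oU C; have := CkM oU (Ck_cst k U (-1)) C.
by apply: Ck_eq => // x Ux; rewrite mulN1r.
Qed.

Lemma CkB k U h1 h2 : open U -> Ck k U h1 -> Ck k U h2 ->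
  Ck k U (fun x => h1 x - h2 x).
Proof. by move=> oU C1 C2; apply: CkD => //; exact: CkN. Qed.

Lemma Ck_sum k U (I : Type) (r : seq I) (F : I -> 'rV[R]_n -> R) : open U ->
  (forall i, Ck k U (F i)) -> Ck k U (fun x => \sum_(i <- r) F i x).
Proof.
move=> oU C; elim: r => [|i r IH].
  by apply: Ck_eq (Ck_cst k U 0) => // x _; rewrite big_nil.
by apply: Ck_eq (CkD oU (C i) IH) => // x _; rewrite big_cons.
Qed.

Lemma Ck_prod k U (I : Type) (r : seq I) (F : I -> 'rV[R]_n -> R) : open U ->
  (forall i, Ck k U (F i)) -> Ck k U (fun x => \prod_(i <- r) F i x).
Proof.
move=> oU C; elim: r => [|i r IH].
  by apply: Ck_eq (Ck_cst k U 1) => // x _; rewrite big_nil.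
by apply: Ck_eq (CkM oU (C i) IH) => // x _; rewrite big_cons.
Qed.

Lemma Ck_det k U p (G : 'rV[R]_n -> 'M[R]_p) : open U ->
  (forall i j, Ck k U (fun x => G x i j)) -> Ck k U (fun x => \det (G x)).
Proof.
move=> oU C; apply: Ck_sum => // s; apply: CkM => //; first exact: Ck_cst.
exact: Ck_prod.
Qed.

(** Cramer's rule: entries of the inverse are cofactors over the determinant. *)
Lemma Ck_invmx k U p (G : 'rV[R]_n -> 'M[R]_p) i j : open U ->
  (forall x, U x -> G x \in unitmx) ->
  (forall i j, Ck k U (fun x => G x i j)) ->
  Ck k U (fun x => invmx (G x) i j).
Proof.
move=> oU uG C.
have dC := Ck_det oU C.
have aC : Ck k U (fun x => \det (row' j (col' i (G x)))).
  by apply: Ck_det => // i' j'; apply: Ck_eq (C _ _) => // x _; rewrite !mxE.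
have d0 x : U x -> \det (G x) != 0.
  by move=> /uG; rewrite unitmxE unitfE.
have := CkM oU (CkV oU d0 dC) (CkM oU (Ck_cst k U ((-1) ^+ (j + i))) aC).
by apply: Ck_eq => // x Ux; rewrite /invmx uG// !mxE.
Qed.

End CkAlgebra.

(** * One-variable calculus along coordinate lines *)

Section AxisCalculus.
Context {R : realType} {n : nat}.
Implicit Types (U : set 'rV[R]_n) (h : 'rV[R]_n -> R) (x w : 'rV[R]_n).

Lemma ball_rowP x r w :
  ball x r w <-> 0 < r /\ forall j, `|x 0 j - w 0 j| < r.
Proof.
split=> [[r0 b]|[r0 b]]; first by split=> // j; exact: b.
by split=> // i j; rewrite ord1; exact: b.
Qed.

Lemma add_axisE w (s : R) (i j : 'I_n) :
  (w + s *: 'e_i) 0 j = w 0 j + s *+ (j == i).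
Proof. by rewrite !mxE eqxx /= mulr_natr. Qed.

(** Balls for the sup norm are boxes, and only the [i]-th coordinate varies with [t]. *)
Lemma ball_axis_segment x r w i (a b t : R) : a <= t <= b ->
  ball x r (w + a *: 'e_i) -> ball x r (w + b *: 'e_i) ->
  ball x r (w + t *: 'e_i).
Proof.
move=> /andP[at_ tb] /ball_rowP[r0 ba] /ball_rowP[_ bb].
apply/ball_rowP; split=> // j; move: (ba j) (bb j); rewrite !add_axisE.
case: eqP => _; rewrite ?mulr1n ?mulr0n //.
rewrite !ltr_distl => /andP[? ?] /andP[? ?]; apply/andP; split; lra.
Qed.

(** Both difference quotients are the same function of the increment, which reduces directional
    derivatives to derivatives of one real variable. *)
Lemma is_derive_line h w v (t : R) : derivable h (w + t *: v) v ->
  is_derive t (1 : R) (fun s : R => h (w + s *: v)) ('D_v h (w + t *: v)).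
Proof.
move=> d.
have e : (fun k : R => k^-1 *: (((fun s : R => h (w + s *: v)) \o shift t) (k *: (1 : R))
     - h (w + t *: v))) =
   (fun k : R => k^-1 *: ((h \o shift (w + t *: v)) (k *: v) - h (w + t *: v))).
  apply/funext => k /=; congr (_ *: (h _ - _)).
  by rewrite [k *: (1 : R)]mulr1 scalerDl addrCA.
by apply: DeriveDef; rewrite /derivable /derive e.
Qed.

Lemma MVT_axis U h w i (a b : R) : a <= b -> Ck 1 U h ->
  (forall t, a <= t <= b -> U (w + t *: 'e_i)) ->
  exists2 c, a <= c <= b &
    h (w + b *: 'e_i) - h (w + a *: 'e_i) =
      partial i h (w + c *: 'e_i) * (b - a).
Proof.
move=> ab C Uab.
pose f (s : R) := h (w + s *: 'e_i).
pose df (s : R) := partial i h (w + s *: 'e_i).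
have d t : t \in `[a, b]%R -> is_derive t (1 : R) f (df t).
  rewrite in_itv /= => /Uab Ut.
  by apply: is_derive_line; exact: CkS_derivable C _.
have d' t : t \in `]a, b[%R -> is_derive t (1 : R) f (df t).
  by move=> /subset_itv_oo_cc; exact: d.
have cf : {within `[a, b], continuous f}.
  by apply: derivable_within_continuous => t /d[].
have [c] := MVT_segment ab d' cf.
by rewrite in_itv /= => cab e; exists c.
Qed.

(** The mean value theorem turns continuity of the partial derivative at [x] into an estimate
    uniform in the base point [w]. This uniformity is needed when the base point itself moves with
    the increment. *)
Lemma axis_strict_differential U h i x (e : R) : open U -> U x -> Ck 1 U h ->
  0 < e -> exists2 d, 0 < d & forall w s, ball x d w -> `|s| < d ->
    `|h (w + s *: 'e_i) - h w - partial i h x * s| <= e * `|s|.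
Proof.
move=> oU Ux C e0.
have cp : {for x, continuous (partial i h)}.
  exact: (Ck_continuous (CkS_partial i C)).
have nU : nbhs x U by exact: open_nbhs_nbhs.
have np : \forall y \near x, `|partial i h x - partial i h y| <= e.
  by move: cp => /cvgrPdist_le; apply.
have [r /= r0 rP] := (nbhs_ballP x _).1 (filterI nU np).
(* One half of [r] is for [w], the other for the displacement from [w]. *)
exists (r / 2) => [|w s xw sr]; first by rewrite divr_gt0.
have rP' t : `|t| <= `|s| -> ball x r (w + t *: 'e_i).
  move=> ts; apply/ball_rowP; split=> // j.
  move/ball_rowP: xw => [_ /(_ j)]; rewrite add_axisE.
  move=> xw; rewrite opprD addrA (le_lt_trans (ler_normB _ _))//.
  rewrite [ltRHS]splitr ltrD// (le_lt_trans _ sr)// (le_trans _ ts)//.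
  by case: eqP => _; rewrite ?mulr0n ?normr0.
suff [c cs ->] : exists2 c, `|c| <= `|s| & h (w + s *: 'e_i) - h w =
    partial i h (w + c *: 'e_i) * s.
  rewrite -mulrBl normrM ler_wpM2r// distrC.
  by have [_] := rP _ (rP' _ cs).
have w0 : w + (0 : R) *: 'e_i = w by rewrite scale0r addr0.
have [s0|s0] := leP 0 s.
- have [t /andP[t1 t2]|c /andP[c1 c2]] := @MVT_axis U h w i 0 s s0 C.
    by apply: (rP _ (rP' _ _)).1; rewrite !ger0_norm// (le_trans t1).
  by rewrite w0 subr0 => ec; exists c => //; rewrite !ger0_norm.
- have [t /andP[t1 t2]|c /andP[c1 c2]] := @MVT_axis U h w i s 0 (ltW s0) C.
    by apply: (rP _ (rP' _ _)).1; rewrite !ler0_norm ?lerN2// ltW.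
  rewrite w0 => ec; exists c; first by rewrite !ler0_norm ?lerN2// ltW.
  by rewrite -opprB ec sub0r mulrN opprK.
Qed.

Lemma is_derive_axis h i x (D : R) :
  (forall e, 0 < e -> exists2 d, 0 < d & forall s, `|s| < d ->
    `|h (x + s *: 'e_i) - h x - D * s| <= e * `|s|) ->
  is_derive x 'e_i h D.
Proof.
move=> H.
have cD : (fun k : R => k^-1 *: ((h \o shift x) (k *: 'e_i) - h x)) @ 0^' --> D.
  apply/cvgrPdist_le => e e0; have [d d0 dP] := H e e0.
  near=> k.
  have k0 : k != 0 by near: k; exact: nbhs_dnbhs_neq.
  have kd : `|k| < d by near: k; exact: dnbhs0_lt.
  have := dP k kd; rewrite /= (addrC (k *: _)) distrC => le1.
  rewrite -(ler_pM2r (x := `|k|)) ?normr_gt0// -normrM mulrBl.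
  by rewrite [k^-1 *: _]mulrC mulfVK.
apply: DeriveDef; first by apply/cvg_ex; exists D.
exact: (cvg_lim _ cD).
Unshelve. all: by end_near. Qed.

End AxisCalculus.

(** * Gronwall's inequality for linear differential inequalities *)

Section Gronwall.
Context {R : realType}.

(** The energy [E], the sum of the squares of the [u k], satisfies [|E'| <= K E] and vanishes at
    [t0]. Unlike the absolute values, it is differentiable. *)
Lemma linear_bound_zero N (u du : 'I_N -> R -> R) (a b t0 C : R) :
  a <= t0 <= b -> 0 <= C ->
  (forall j t, a <= t <= b -> is_derive t (1 : R) (u j) (du j t)) ->
  (forall j t, a <= t <= b -> `|du j t| <= C * \sum_k `|u k t|) ->
  (forall j, u j t0 = 0) ->
  forall j t, a <= t <= b -> u j t = 0.
Proof.
move=> t0ab C0 dU bU u0 j t tab.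
pose dE s := \sum_k (u k s *: du k s + u k s *: du k s).
have [E [EE dEP]] : exists E : R -> R, (forall s, E s = \sum_k u k s ^+ 2) /\
    forall s, a <= s <= b -> is_derive s (1 : R) E (dE s).
  exists (\sum_(k < N) (u k * u k)); split=> [s|s sab].
    by rewrite fct_sumE; apply: eq_bigr => k _; rewrite expr2.
  apply: is_derive_sum => k.
  by have ? := dU k s sab; exact: is_deriveM.
have E_ge0 s : 0 <= E s by rewrite EE; apply: sumr_ge0 => k _; exact: sqr_ge0.
(* Each [|2 u_k u_k'|] is at most [C] times the sum over [l] of [2 |u_k u_l| <= u_k^2 + u_l^2];
   summing over [k] produces [2 * N]. *)
pose K := 2 * C * N%:R.
have dEle s : a <= s <= b -> `|dE s| <= K * E s.
  move=> sab; rewrite (le_trans (ler_norm_sum _ _ _))//.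
  have le1 k : `|u k s *: du k s + u k s *: du k s| <=
      C * \sum_l (u k s ^+ 2 + u l s ^+ 2).
    rewrite -mulr2n normrMn [_ *: _]/(_ * _) normrM.
    have := ler_wpM2l (normr_ge0 (u k s)) (bU k s sab).
    rewrite mulrCA -(ler_pMn2r (n := 2))// => /le_trans; apply.
    rewrite -mulrnAr ler_wpM2l// mulr_sumr -sumrMnl ler_sum// => l _.
    have := sqr_ge0 (`|u k s| - `|u l s|).
    by rewrite sqrrB !real_normK ?num_real// => ?; lra.
  have sumE : \sum_k \sum_l (u k s ^+ 2 + u l s ^+ 2) = 2 * N%:R * E s.
    transitivity (\sum_(k < N) (u k s ^+ 2 *+ N + E s)).
      apply: eq_bigr => k _; rewrite big_split /= sumr_const card_ord.
      by rewrite EE.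
    rewrite big_split /= sumrMnl -EE sumr_const card_ord -mulr_natr.
    by ring.
  rewrite (le_trans (ler_sum _ (fun k _ => le1 k)))// -mulr_sumr sumE /K.
  by rewrite !mulrA (mulrC C).
have Et0 : E t0 = 0.
  by rewrite EE big1// => k _; rewrite u0 expr0n.
suff Et : E t <= 0.
  have : \sum_k u k t ^+ 2 = 0 by apply/eqP; rewrite eq_le -EE Et E_ge0.
  move/eqP; rewrite psumr_eq0; last by move=> k _; exact: sqr_ge0.
  by move/allP/(_ j (mem_index_enum _)); rewrite /= sqrf_eq0 => /eqP.
(* Multiplying by [expR (- L * s)] absorbs the growth rate [L]: with [L = K]
   the product is nonincreasing, with [L = - K] it is nondecreasing. *)
have dP (L : R) s : a <= s <= b -> is_derive s (1 : R)
    (fun r => E r * expR (- L * r)) ((dE s - L * E s) * expR (- L * s)).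
  move=> sab; have dEs := dEP s sab.
  have dl : is_derive s (1 : R) (fun r : R => - L * r) (- L).
    have := @is_deriveZ R R R id (- L) s 1 1 (is_derive_id s (1 : R)).
    by rewrite [_ *: 1]mulr1; apply.
  have dx : is_derive s (1 : R) (fun r => expR (- L * r)) (expR (- L * s) * - L).
    exact: (is_derive1_comp (is_derive_expR _) dl).
  have := is_deriveM dEs dx; congr (is_derive _ _ _ _).
  by rewrite /GRing.scale /=; ring.
have cP (L : R) c d : a <= c -> d <= b ->
    {within `[c, d], continuous (fun r => E r * expR (- L * r))}.
  move=> ac db; apply: derivable_within_continuous => s.
  by rewrite in_itv /= => /andP[cs sd]; have [] := dP L s;
  rewrite ?(le_trans ac) ?(le_trans sd).
have [t0a t0b] := andP t0ab; have [ta tb] := andP tab.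
have [t0t|tt0] := leP t0 t.
- have dP' s : s \in `]t0, t[%R -> is_derive s (1 : R)
      (fun r => E r * expR (- K * r)) ((dE s - K * E s) * expR (- K * s)).
    rewrite in_itv /= => /andP[ts st].
    by apply: dP; rewrite (le_trans t0a (ltW ts)) (le_trans (ltW st) tb).
  have [z] := MVT_segment t0t dP' (cP K _ _ t0a tb).
  rewrite in_itv /= Et0 mul0r subr0 => /andP[tz zt] e.
  rewrite -(pmulr_lle0 _ (expR_gt0 (- K * t))) e.
  rewrite mulr_le0_ge0 ?subr_ge0// pmulr_lle0 ?expR_gt0// subr_le0.
  rewrite (le_trans (ler_norm _))// dEle//.
  by rewrite (le_trans t0a tz) (le_trans zt tb).
- have dP' s : s \in `]t, t0[%R -> is_derive s (1 : R)
      (fun r => E r * expR (- - K * r)) ((dE s - - K * E s) * expR (- - K * s)).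
    rewrite in_itv /= => /andP[ts st].
    by apply: dP; rewrite (le_trans ta (ltW ts)) (le_trans (ltW st) t0b).
  have [z] := MVT_segment (ltW tt0) dP' (cP (- K) _ _ ta t0b).
  rewrite in_itv /= Et0 mul0r sub0r => /andP[tz zt] /(congr1 -%R).
  rewrite opprK => e.
  rewrite -(pmulr_lle0 _ (expR_gt0 (- - K * t))) e oppr_le0.
  rewrite mulr_ge0 ?subr_ge0 ?(ltW tt0)// mulr_ge0 ?expR_ge0// mulNr opprK.
  rewrite -(opprK (dE z)) addrC subr_ge0 (le_trans (ler_norm _))// normrN dEle//.
  by rewrite (le_trans ta tz) (le_trans zt t0b).
Qed.

End Gronwall.

(** * Propagation of a vanishing 1-jet *)

Section JetPropagation.
Context {R : realType} {n : nat}.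
Implicit Types (U : set 'rV[R]_n) (h : 'rV[R]_n -> R) (x w : 'rV[R]_n).

Definition zero_jet h x := h x = 0 /\ forall j, partial j h x = 0.

Section Bounded.
Context (U : set 'rV[R]_n) (h : 'rV[R]_n -> R) (x : 'rV[R]_n) (r C : R).
Context (hU : Ck 2 U h) (C0 : 0 <= C) (rU : ball x r `<=` U).
Context (hC : forall y, ball x r y -> forall i j,
  `|partial i (partial j h) y| <= C * (`|h y| + \sum_k `|partial k h y|)).

Lemma zero_jet_axis w i (s : R) : ball x r w -> ball x r (w + s *: 'e_i) ->
  zero_jet h w -> zero_jet h (w + s *: 'e_i).
Proof.
move=> wr wsr [hw0 dhw0].
have w0 : w + (0 : R) *: 'e_i = w by rewrite scale0r addr0.
(* The interval between 0 and [s], whatever the sign of [s]. *)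
pose a := Num.min 0 s; pose b := Num.max 0 s.
have abr t : a <= t <= b -> ball x r (w + t *: 'e_i).
  rewrite /a /b; case: (leP 0 s) => s0 tab; apply: (ball_axis_segment tab) => //;
  by rewrite w0.
(* The 1-jet as a vector of length [n.+1]: index 0 holds [h], index [lift ord0 j] holds
   [partial j h]. *)
pose u k : R -> R := if unlift ord0 k is Some j
  then fun t => partial j h (w + t *: 'e_i) else fun t => h (w + t *: 'e_i).
pose du (k : 'I_n.+1) : R -> R := if unlift ord0 k is Some j
  then fun t => partial i (partial j h) (w + t *: 'e_i)
  else fun t => partial i h (w + t *: 'e_i).
have uS t : \sum_k `|u k t| = `|h (w + t *: 'e_i)| +
    \sum_k `|partial k h (w + t *: 'e_i)|.
  rewrite big_ord_recl /u unlift_none; congr (_ + _).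
  by apply: eq_bigr => k _; rewrite liftK.
have dU k t : a <= t <= b -> is_derive t (1 : R) (u k) (du k t).
  move=> /abr /rU Ut; rewrite /u /du; case: unliftP => [j _|_].
    by apply: is_derive_line; exact: CkS_derivable (CkS_partial j hU) _.
  by apply: is_derive_line; exact: CkS_derivable hU _.
(* [C] serves the components [partial j h]; the extra 1 serves [h], whose derivative is itself an
   entry of the jet. *)
have bU k t : a <= t <= b -> `|du k t| <= (C + 1) * \sum_k `|u k t|.
  move=> /abr tr; rewrite uS /du mulrDl mul1r; case: unliftP => [j _|_].
    by rewrite (le_trans (hC tr i j))// lerDl addr_ge0// sumr_ge0.
  have le1 : `|partial i h (w + t *: 'e_i)| <= \sum_k `|partial k h (w + t *: 'e_i)|.
    by rewrite (bigD1 i) //= lerDl sumr_ge0.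
  rewrite (le_trans le1)// addrA lerDr addr_ge0// mulr_ge0// addr_ge0//.
  by rewrite sumr_ge0.
have u0 k : u k 0 = 0 by rewrite /u; case: unliftP => [j _|_]; rewrite w0.
have ab0 : a <= 0 <= b by rewrite /a /b ge_min le_max lexx.
have abs : a <= s <= b by rewrite /a /b ge_min le_max lexx !orbT.
have us := linear_bound_zero ab0 (addr_ge0 C0 ler01) dU bU u0 _ abs.
split; first by have := us ord0; rewrite /u unlift_none.
by move=> j; have := us (lift ord0 j); rewrite /u liftK.
Qed.

(** The point [y] is reached from [x] by changing one coordinate at a time; the intermediate points
    [z k], with the first [k] coordinates already those of [y], stay in the box. *)
Lemma zero_jet_ball y : ball x r y -> zero_jet h x -> zero_jet h y.
Proof.
move=> xy hx; have /ball_rowP[r0 xyj] := xy.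
pose z k : 'rV[R]_n := \row_j (if (j < k)%N then y 0 j else x 0 j).
have zr k : ball x r (z k).
  by apply/ball_rowP; split=> // j; rewrite mxE; case: ifP; rewrite ?subrr ?normr0.
have zn : z n = y by apply/rowP => j; rewrite mxE ltn_ord.
suff : forall k, (k <= n)%N -> zero_jet h (z k) by rewrite -zn; apply.
elim=> [_|k IH kn].
  by have -> : z 0%N = x by apply/rowP => j; rewrite mxE.
pose i := Ordinal kn.
have zS : z k.+1 = z k + (y 0 i - x 0 i) *: 'e_i.
  apply/rowP => j; rewrite add_axisE !mxE ltnS leq_eqVlt.
  have [->|ji] := eqVneq j i; first by rewrite eqxx ltnn mulr1n addrC subrK.
  by rewrite -(inj_eq val_inj) in ji *; rewrite (negbTE ji) mulr0n addr0.
by rewrite zS; apply: zero_jet_axis (IH (ltnW kn)); rewrite -?zS.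
Qed.

End Bounded.
End JetPropagation.

Lemma continuous_at_ball (R : realType) n (T : topologicalType)
    (f : T -> 'rV[R]_n) p :
  (forall e, 0 < e -> \forall t \near p, ball (f p) e (f t)) ->
  {for p, continuous f}.
Proof. by move=> fb; apply/cvg_ballP. Qed.

Lemma rV_continuous_at (R : realType) n (T : topologicalType)
    (f : T -> 'rV[R]_n) p :
  (forall j, {for p, continuous (fun t => f t 0 j)}) -> {for p, continuous f}.
Proof.
move=> fc; apply: continuous_at_ball => e e0.
have nj : \forall t \near p, forall j : 'I_n, `|f p 0 j - f t 0 j| < e.
  apply: filter_forall => j.
  by move: (fc j) => /cvgrPdist_lt; apply.
by apply: filterS nj => t nj; apply/ball_rowP.
Qed.

Lemma open_ball_sub (R : realType) n (U : set 'rV[R]_n) x : open U -> U x ->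
  exists2 r, 0 < r & ball x r `<=` U.
Proof.
move=> oU Ux; have := (nbhs_ballP x U).1 (open_nbhs_nbhs (conj oU Ux)).
by move=> [r /= r0 rU]; exists r.
Qed.

(** * An inverse function theorem for replacing one coordinate by a function *)

Section Straighten.
Context {R : realType} {n : nat} (a : 'I_n).

Definition straighten (h : 'rV[R]_n -> R) (x : 'rV[R]_n) : 'rV[R]_n :=
  \row_k if k == a then h x else x 0 k.

Lemma straightenE h x k :
  straighten h x 0 k = if k == a then h x else x 0 k.
Proof. by rewrite mxE. Qed.

Context (U : set 'rV[R]_n) (F : 'rV[R]_n -> R) (x0 : 'rV[R]_n) (r : R).
Context (sF : Csmooth U F) (rU : ball x0 r `<=` U).
Context (dF : forall x, ball x0 r x -> 0 < partial a F x).
Local Notation B := (ball x0 r).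
Local Notation Phi := (straighten F).

(** The inverse of [Phi] on [B], by choice; off the image of [B] it takes the default value [x0]. *)
Definition unstraighten (y : 'rV[R]_n) : 'rV[R]_n :=
  xget x0 [set x | B x /\ Phi x = y].
Local Notation Psi := unstraighten.

Lemma increasing_axis w (s t : R) : s < t ->
  B (w + s *: 'e_a) -> B (w + t *: 'e_a) ->
  F (w + s *: 'e_a) < F (w + t *: 'e_a).
Proof.
move=> st Bs Bt.
have Bst u : s <= u <= t -> B (w + u *: 'e_a).
  by move=> ut; exact: ball_axis_segment ut Bs Bt.
have [|c cst e] := MVT_axis (ltW st) (sF 1%N) (w := w) (i := a).
  by move=> u su; apply: rU; exact: Bst.
by rewrite -subr_gt0 e mulr_gt0 ?subr_gt0//; apply: dF; exact: Bst.
Qed.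

(** Points with the same image differ only in the [a]-th coordinate, along which [F] is strictly
    increasing. *)
Lemma straighten_inj x x' : B x -> B x' -> Phi x = Phi x' -> x = x'.
Proof.
move=> Bx Bx' e.
have e' k := congr1 (fun v : 'rV[R]_n => v 0 k) e.
have xx' : x' = x + (x' 0 a - x 0 a) *: 'e_a.
  apply/rowP => k; rewrite add_axisE; have [->|ka] := eqVneq k a.
    by rewrite mulr1n addrC subrK.
  by have := e' k; rewrite !straightenE (negbTE ka) mulr0n addr0 => ->.
have Fe : F x = F x' by have := e' a; rewrite !straightenE eqxx.
have w0 : x + (0 : R) *: 'e_a = x by rewrite scale0r addr0.
move: xx'; set s := _ - _ => xx'.
have [s0|s0|s0] := ltgtP s 0; last by rewrite xx' s0 w0.
- by have := increasing_axis (w := x) s0; rewrite -xx' w0 Fe ltxx => /(_ Bx' Bx).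
- by have := increasing_axis (w := x) s0; rewrite -xx' w0 Fe ltxx => /(_ Bx Bx').
Qed.

Lemma F_continuous x : U x -> {for x, continuous F}.
Proof. by move=> Ux; exact: (Ck_continuous (sF 0%N)). Qed.

(* The intermediate value theorem along the [a]-axis through each point. *)
Lemma straighten_open_at x (e : R) : B x -> 0 < e -> exists2 d, 0 < d &
  forall y, ball (Phi x) d y -> exists x', [/\ B x', ball x e x' & Phi x' = y].
Proof.
move=> Bx e0.
have oB : open B by exact: ball_open.
have [r1 r10 r1B] := open_ball_sub oB Bx.
(* The box of radius [r2] lies in [B] and in the ball of radius [e]; [s] is the half-length of the
   axis segment on which the preimage is sought. *)
pose r2 := Num.min r1 e; pose s := r2 / 2.
have r20 : 0 < r2 by rewrite lt_min r10.
have s0 : 0 < s by rewrite divr_gt0.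
have sr2 : s < r2 by rewrite /s; lra.
have r2B z : ball x r2 z -> B z /\ ball x e z.
  move=> /ball_rowP[_ z2]; split; [apply: r1B|]; apply/ball_rowP; split=> // j;
  by have := z2 j; rewrite lt_min => /andP[].
have w0 : x + (0 : R) *: 'e_a = x by rewrite scale0r addr0.
have axB (t : R) : `|t| <= s -> B (x + t *: 'e_a).
  move=> ts; apply: (r2B _ _).1; apply/ball_rowP; split=> // j.
  rewrite add_axisE opprD addrA subrr sub0r normrN.
  by apply: le_lt_trans sr2; case: eqP => _; rewrite ?normr0 // ltW.
have sn : `|s| <= s by rewrite gtr0_norm.
have Nsn : `|- s| <= s by rewrite normrN gtr0_norm.
have Bx0 : B (x + (0 : R) *: 'e_a) by rewrite w0.
have Fp : F x < F (x + s *: 'e_a).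
  by have := increasing_axis s0 Bx0 (axB _ sn); rewrite w0.
have Fm : F (x + (- s) *: 'e_a) < F x.
  have Ns0 : - s < 0 by rewrite oppr_lt0.
  by have := increasing_axis Ns0 (axB _ Nsn) Bx0; rewrite w0.
(* Half the smaller gap, so that [F] at the two ends of the segment clears [F x] by more than
   [m]. *)
pose m := Num.min (F (x + s *: 'e_a) - F x) (F x - F (x + (- s) *: 'e_a)) / 2.
have m0 : 0 < m by rewrite divr_gt0// lt_min !subr_gt0 Fp.
have mp : F x + m < F (x + s *: 'e_a).
  have : m * 2 <= F (x + s *: 'e_a) - F x by rewrite /m divfK// ge_min lexx.
  by move=> ?; lra.
have mm : F (x + (- s) *: 'e_a) < F x - m.
  have : m * 2 <= F x - F (x + (- s) *: 'e_a).
    by rewrite /m divfK// ge_min lexx orbT.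
  by move=> ?; lra.
have [d1 /= d10 d1P] := (nbhs_ballP _ _).1
  (cvgr_gt _ (F_continuous (rU (axB _ sn))) _ mp).
have [d2 /= d20 d2P] := (nbhs_ballP _ _).1
  (cvgr_lt _ (F_continuous (rU (axB _ Nsn))) _ mm).
(* [d1] and [d2] keep the end values beyond [F x + m] and [F x - m] on the shifted segment, [m]
   keeps the target between them, and [s] keeps the shifted segment in the box. *)
pose d := Num.min (Num.min d1 d2) (Num.min m s).
have d0 : 0 < d by rewrite !lt_min d10 d20 m0.
exists d => // y /ball_rowP[_ yd].
have ydk k : k != a -> `|x 0 k - y 0 k| < d.
  by move=> ka; have := yd k; rewrite straightenE (negbTE ka).
have yda : `|F x - y 0 a| < d by have := yd a; rewrite straightenE eqxx.
(* All coordinates but the [a]-th are prescribed by [y]; the last one comes from the intermediate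
   value theorem. *)
pose w : 'rV[R]_n := \row_k if k == a then x 0 a else y 0 k.
have wd (t e' : R) : d <= e' -> ball (x + t *: 'e_a) e' (w + t *: 'e_a).
  move=> de'; apply/ball_rowP; split=> [|k]; first exact: lt_le_trans de'.
  rewrite !add_axisE mxE opprD addrACA subrr addr0; case: eqVneq => [->|ka].
    by rewrite subrr normr0 (lt_le_trans d0).
  exact: lt_le_trans (ydk k ka) _.
have wr2 (t : R) : `|t| <= s -> ball x r2 (w + t *: 'e_a).
  move=> ts; apply/ball_rowP; split=> // k.
  rewrite add_axisE mxE; case: eqVneq => [->|ka].
    by rewrite mulr1n opprD addrA subrr sub0r normrN (le_lt_trans ts).
  rewrite mulr0n addr0 (lt_trans (ydk k ka))// (le_lt_trans _ sr2)//.
  by rewrite !ge_min lexx !orbT.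
have Fwp : F x + m < F (w + s *: 'e_a).
  by apply: d1P; apply: wd; rewrite !ge_min lexx.
have Fwm : F (w + (- s) *: 'e_a) < F x - m.
  by apply: d2P; apply: wd; rewrite !ge_min lexx orbT.
have dm : d <= m by rewrite !ge_min lexx !orbT.
have [yl yu] : F x - m < y 0 a /\ y 0 a < F x + m.
  move: yda; rewrite ltr_distl => /andP[? ?]; split; lra.
pose f (t : R) := F (w + t *: 'e_a).
have ss : - s <= s by rewrite ge0_cp// ltW.
have cf : {within `[- s, s], continuous f}.
  apply: derivable_within_continuous => t; rewrite in_itv /= -ler_norml => ts.
  have Ut := rU (r2B _ (wr2 _ ts)).1.
  by have [] := is_derive_line (CkS_derivable (i := a) (sF 1%N) Ut).
have [|t] := @IVT R f _ _ (y 0 a) ss cf.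
  by rewrite ge_min le_max /f (ltW (lt_trans Fwm yl)) (ltW (lt_trans yu Fwp)) orbT.
rewrite in_itv /= -ler_norml => ts ft.
exists (w + t *: 'e_a); have [? ?] := r2B _ (wr2 _ ts); split=> //.
apply/rowP => k; rewrite straightenE; case: eqVneq => [->//|ka].
by rewrite add_axisE mxE (negbTE ka) mulr0n addr0.
Qed.

Lemma straightenK x : B x -> Psi (Phi x) = x.
Proof.
move=> Bx; rewrite /Psi; case: xgetP => [z _ [Bz e]|/(_ x)[]//].
exact: straighten_inj.
Qed.

Lemma straighten_continuous x : U x -> {for x, continuous Phi}.
Proof.
move=> Ux; apply: rV_continuous_at => k.
have [->|ka] := eqVneq k a.
  have -> : (fun t => Phi t 0 a) = F.
    by apply/funext => t; rewrite straightenE eqxx.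
  exact: F_continuous.
have -> : (fun t => Phi t 0 k) = (fun t => t 0 k).
  by apply/funext => t; rewrite straightenE (negbTE ka).
exact: coord_continuous.
Qed.

Lemma straighten_open W : open W -> W `<=` B -> open (Phi @` W).
Proof.
move=> oW WB; rewrite openE => _ [x Wx <-].
have [e e0 eW] := open_ball_sub oW Wx.
have [d d0 dP] := straighten_open_at (WB _ Wx) e0.
apply/nbhs_ballP; exists d => //= y /dP[x' [_ /eW Wx' <-]].
by exists x'.
Qed.

(** This is [straighten_open_at] read backwards: values near [Phi x] have preimages near [x], and
    injectivity makes them the values of [Psi]. *)
Lemma unstraighten_continuous x : B x -> {for Phi x, continuous Psi}.
Proof.
move=> Bx; apply: continuous_at_ball => e e0.
have [d d0 dP] := straighten_open_at Bx e0.
apply: (filterS _ (nbhsx_ballx (Phi x) d d0)) => y /dP[x' [Bx' xx' <-]].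
by rewrite !straightenK.
Qed.

(** The chain rule in the coordinates where [F] replaces [x^a]: the new fields are [d_a / F_a] and,
    for [i != a], [d_i - (F_i / F_a) d_a]. *)
Definition straight_partial (i : 'I_n) (h : 'rV[R]_n -> R) (x : 'rV[R]_n) : R :=
  if i == a then partial a h x / partial a F x
  else partial i h x - partial a h x / partial a F x * partial i F x.

(* With [c = d_a h / d_a F] at [x], the function [h - c F] has no [a]-derivative
   at [x], while [F] is an explicit coordinate of the new chart; so only a crude
   bound on the [a]-displacement of [Psi] is needed. *)
Lemma is_derive_unstraighten W h x i : open W -> W `<=` B -> W x -> Ck 1 W h ->
  is_derive (Phi x) 'e_i (h \o Psi) (straight_partial i h x).
Proof.
move=> oW WB Wx C1; have Bx := WB _ Wx; have Ux := rU Bx.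
set p := partial a F x; have p0 : 0 < p by exact: dF.
set c := partial a h x / p; pose q := partial i F x.
pose G := fun z => h z - c * F z.
have FW : Ck 1 W F by apply: Ck_subset (sF 1%N) => z /WB /rU.
have cFW : Ck 1 W (fun z => c * F z) by apply: CkM => //; exact: Ck_cst.
have GW : Ck 1 W G by exact: CkB.
have dG k : partial k G x = partial k h x - c * partial k F x.
  have dcF := CkS_derivable (i := k) cFW Wx.
  rewrite /partial (deriveB (CkS_derivable C1 Wx) dcF); congr (_ - _).
  have -> : (fun z => c * F z) = c *: F by [].
  by rewrite deriveZ//; exact: CkS_derivable FW Wx.
have dGa : partial a G x = 0.
  by rewrite dG /c divfK ?subrr// gt_eqF.
pose g := partial i G x.
(* The ratio [K] bounds the [a]-displacement [rho] by [K * |t|]: expanding [F] gives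
   [p |rho| <= (2 + |q|) |t| + (p / 2) |rho|], and the last term is absorbed. *)
pose K := (2 + `|q|) / (p / 2).
have K0 : 0 <= K by rewrite divr_ge0 ?addr_ge0// ?divr_ge0// ltW.
apply: is_derive_axis => e e0.
have e'0 : 0 < e / (1 + K) by rewrite divr_gt0// ltr_pwDl.
(* The two increments of [G] cost [e' * K * |t|] and [e' * |t|], in total [e * |t|]. *)
set e' := e / (1 + K) in e'0.
have p20 : 0 < p / 2 by rewrite divr_gt0.
have [d1 d10 D1] := axis_strict_differential i oW Wx FW ltr01.
have [d2 d20 D2] := axis_strict_differential a oW Wx FW p20.
have [d3 d30 D3] := axis_strict_differential i oW Wx GW e'0.
have [d4 d40 D4] := axis_strict_differential a oW Wx GW e'0.
pose d := Num.min (Num.min d1 d2) (Num.min d3 d4).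
have d0 : 0 < d by rewrite !lt_min d10 d20 d30.
have [dd1 dd2 dd3 dd4] : [/\ d <= d1, d <= d2, d <= d3 & d <= d4].
  by rewrite /d !ge_min !lexx !orbT.
have [r1 r10 r1P] := straighten_open_at Bx d0.
exists (Num.min r1 d) => [|t]; first by rewrite lt_min r10.
rewrite lt_min => /andP[tr1 td].
have [z [Bz xz ez]] : exists z, [/\ B z, ball x d z & Phi z = Phi x + t *: 'e_i].
  apply: r1P; apply/ball_rowP; split=> // k; rewrite add_axisE opprD addrA.
  by rewrite subrr sub0r normrN; case: eqP => _; rewrite ?normr0.
rewrite /= -ez !straightenK//.
(* The path from [x] to [z] first moves by [s] along [e_i], to [w], then by [rho] along [e_a]; when
   [i = a] the first move is trivial. *)
pose b := i == a; pose s := t *+ ~~ b; pose rho := z 0 a - x 0 a.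
pose w := x + s *: 'e_i.
have ezk k : (Phi z) 0 k = (Phi x) 0 k + t *+ (k == i) by rewrite ez add_axisE.
have zw : z = w + rho *: 'e_a.
  apply/rowP => k; rewrite !add_axisE; case: (eqVneq k a) => [->|ka].
    rewrite /rho mulr1n /s /b (eq_sym a); case: eqP => _;
    rewrite ?mulr0n ?mul0rn addr0;
    by rewrite addrC subrK.
  rewrite mulr0n addr0; have := ezk k; rewrite !straightenE (negbTE ka) => ->.
  rewrite /s /b; congr (_ + _); case: (eqVneq k i) => [ki|]; rewrite ?mulr0n//.
  by rewrite -ki ka !mulr1n.
have Fz : F z - F x = t *+ b.
  have := ezk a; rewrite !straightenE eqxx => ->; rewrite (eq_sym a).
  by rewrite addrAC subrr add0r.
have st : `|s| <= `|t| by rewrite /s; case: (~~ b); rewrite ?mulr0n ?normr0.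
have rhod : `|rho| < d.
  by move/ball_rowP: xz => [_ /(_ a)]; rewrite distrC.
have xx e1 : 0 < e1 -> ball x e1 x by exact: ballxx.
have xw e1 : d <= e1 -> ball x e1 w.
  move=> de1; apply/ball_rowP; split=> [|k]; first exact: lt_le_trans de1.
  rewrite add_axisE opprD addrA subrr sub0r normrN.
  case: eqP => _; last by rewrite mulr0n normr0 (lt_le_trans d0).
  by rewrite (le_lt_trans st)// (lt_le_trans td).
have sd e1 : d <= e1 -> `|s| < e1 by move=> de1; rewrite (le_lt_trans st)// (lt_le_trans td).
have rd e1 : d <= e1 -> `|rho| < e1 by exact: lt_le_trans.
have Fxw := D1 x s (xx _ d10) (sd _ dd1).
have Fwz := D2 w rho (xw _ dd2) (rd _ dd2).
have Gxw := D3 x s (xx _ d30) (sd _ dd3).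
have Gwz := D4 w rho (xw _ dd4) (rd _ dd4).
rewrite -/w in Fxw Gxw; rewrite -zw in Fwz Gwz.
rewrite dGa mul0r subr0 in Gwz.
rewrite -/p -/q -/g in Fxw Fwz Gxw.
have rhoK : `|rho| <= K * `|t|.
  have tb : `|t *+ b| <= `|t| by case: (b); rewrite ?mulr0n ?normr0.
  have prho : p * rho = t *+ b - (F w - F x - q * s) - q * s - (F z - F w - p * rho).
    by rewrite -Fz; ring.
  have : `|p * rho| <= `|t| + `|t| + `|q| * `|t| + p / 2 * `|rho|.
    rewrite {1}prho (le_trans (ler_normB _ _))// lerD//.
    rewrite (le_trans (ler_normB _ _))// lerD//; last first.
      by rewrite normrM ler_wpM2l.
    by rewrite (le_trans (ler_normB _ _))// lerD// (le_trans Fxw)// mul1r.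
  rewrite normrM (gtr0_norm p0) => le1.
  by rewrite /K mulrAC ler_pdivlMr//; lra.
have -> : h z - h x - straight_partial i h x * t = (G z - G w) + (G w - G x - g * s).
  have -> : h z - h x = (G z - G x) + c * (F z - F x) by rewrite /G; ring.
  rewrite Fz /straight_partial -/p -/c /g dG /s /b; case: eqVneq => [ia|ia] /=.
    by rewrite mulr0n mulr1n; ring.
  by rewrite mulr0n mulr1n; ring.
rewrite (le_trans (ler_normD _ _))//.
have -> : e * `|t| = e' * (K * `|t|) + e' * `|t|.
  by rewrite /e'; field; rewrite gt_eqF// ltr_pwDl.
rewrite lerD//; [apply: (le_trans Gwz)|apply: (le_trans Gxw)];
by rewrite ler_wpM2l// ltW.
Qed.

(** By induction on [k]: a partial derivative of [h \o Psi] is [straight_partial i h \o Psi], again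
    a function of the same shape, one order lower. *)
Lemma Ck_unstraighten k W h : open W -> W `<=` B -> Ck k W h ->
  Ck k (Phi @` W) (h \o Psi).
Proof.
move=> oW WB; elim: k h => [|k IH] h C.
  split=> // _ [x Wx <-]; apply: continuous_comp.
    exact: unstraighten_continuous (WB _ Wx).
  by rewrite straightenK; [exact: (Ck_continuous C)|exact: WB].
split=> [_ [x Wx <-]|i].
  apply: continuous_comp; first exact: unstraighten_continuous (WB _ Wx).
  by rewrite straightenK; [exact: (Ck_continuous C)|exact: WB].
have C1 : Ck 1 W h by elim: (k) C => [|l IHl] // /CkS.
have dP x : W x -> is_derive (Phi x) 'e_i (h \o Psi) (straight_partial i h x).
  by move=> Wx; exact: is_derive_unstraighten oW WB Wx C1.
split=> [_ [x Wx <-]|]; first by have [] := dP x Wx.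
have FW j l : Ck l W (partial j F).
  by apply: Ck_subset (Csmooth_partial j sF l) => x /WB /rU.
have Fa0 x : W x -> partial a F x != 0 by move=> /WB /dF /gt_eqF ->.
have quot : Ck k W (fun x => partial a h x / partial a F x).
  by apply: CkM => //; [exact: CkS_partial|exact: CkV].
have SP : Ck k W (straight_partial i h).
  rewrite /straight_partial; case: eqP => _ //.
  by apply: CkB => //; [exact: CkS_partial|exact: CkM].
apply: Ck_eq (IH _ SP); first exact: straighten_open.
move=> _ [x Wx <-]; rewrite /= straightenK; last exact: WB.
by rewrite /partial; have [_ ->] := dP x Wx.
Qed.

End Straighten.

(** * Smoothness of Christoffel symbols and Ricci curvature *)

Section MetricRegularity.
Context {R : realType} {n : nat}.

(** A nonzero [v] with [v *m B = 0] would annihilate the quadratic form. *)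
Lemma posdef_unitmx (B : 'M[R]_n) :
  (forall v : 'rV[R]_n, v != 0 -> 0 < (v *m B *m v^T) 0 0) -> B \in unitmx.
Proof.
move=> Bpos; rewrite -row_free_unit -kermx_eq0; apply/negPn/negP.
move=> /rowV0Pn[v /sub_kermxP vB /Bpos].
by rewrite vB mul0mx mxE ltxx.
Qed.

Context (U : set 'rV[R]_n) (G : 'rV[R]_n -> 'M[R]_n).
Context (oU : open U) (uG : forall x, U x -> G x \in unitmx).
Context (sG : forall i j, Csmooth U (fun x => G x i j)).

Lemma Csmooth_christoffel k i j : Csmooth U (christoffel G k i j).
Proof.
move=> l; apply: CkM => //; first exact: Ck_cst.
apply: Ck_sum => // s; apply: CkM => //.
  by apply: Ck_invmx => // i' j'; exact: sG.
have dG a b d : Ck l U (partial a (fun z => G z b d)).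
  exact: Csmooth_partial.
by apply: CkB => //; exact: CkD.
Qed.

Lemma Csmooth_ricci i j : Csmooth U (ricci G i j).
Proof.
move=> l; apply: Ck_sum => // k.
have dC a b c d : Ck l U (partial a (christoffel G b c d)).
  by apply: Csmooth_partial; exact: Csmooth_christoffel.
apply: CkD => //; first exact: CkB.
by apply: Ck_sum => // s; apply: CkB => //; apply: CkM => //; exact: Csmooth_christoffel.
Qed.

End MetricRegularity.

(** * Transfer between a manifold and its charts *)

Section Charts.
Context {R : realType} {n : nat} {M : topologicalType}.
Implicit Types (c d e : chart R n M) (p q : M).

Lemma chart_imgP c x : chart_img c x ->
  chart_dom c (chart_inv c x) /\ c (chart_inv c x) = x.
Proof. by move=> [p cp <-]; rewrite chart_funK. Qed.

Lemma chart_img_fun c p : chart_dom c p -> chart_img c (c p).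
Proof. by move=> cp; exists p. Qed.

Lemma chart_dom_nbhs c p : chart_dom c p -> nbhs p (chart_dom c).
Proof. by move=> cp; apply: open_nbhs_nbhs; split=> //; exact: chart_dom_open. Qed.

Lemma chart_preimage_open c W : open W -> open (chart_dom c `&` c @^-1` W).
Proof.
move=> oW; rewrite openE => p [cp Wcp].
apply: filterI; first exact: chart_dom_nbhs.
by apply: (chart_fun_cont cp); exact: open_nbhs_nbhs.
Qed.

Lemma chart_image_open c (V : set M) : open V -> open (c @` (chart_dom c `&` V)).
Proof.
move=> oV; rewrite openE => _ [p [cp Vp] <-].
have icp := chart_img_fun cp.
have nU : nbhs (c p) (chart_img c).
  by apply: open_nbhs_nbhs; split=> //; exact: chart_img_open.
have nV : nbhs (c p) (chart_inv c @^-1` V).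
  by apply: (chart_inv_cont icp); rewrite chart_funK//; exact: open_nbhs_nbhs.
apply: filterS2 nU nV => x /chart_imgP[dx cx] Vx.
by exists (chart_inv c x).
Qed.

Lemma chart_near c p (P : M -> Prop) : chart_dom c p ->
  (\forall q \near p, P q) -> \forall x \near c p, P (chart_inv c x).
Proof.
by move=> cp nP; apply: (chart_inv_cont (chart_img_fun cp)); rewrite chart_funK.
Qed.

Context {A : smoothStructure R n M}.

Lemma smooth_function_continuous (f : M -> R) :
  smooth_function A f -> continuous f.
Proof.
move=> sf p; have [c Ac cp] := atlas_cover A p.
have e q : chart_dom c q -> ((f \o chart_inv c) \o c) q = f q.
  by move=> cq; rewrite /= chart_funK.
apply: (eq_continuous_at (chart_dom_open c) cp e).
apply: continuous_comp; first exact: chart_fun_cont.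
exact: (Ck_continuous (sf c Ac 0%N)) (chart_img_fun cp).
Qed.

Lemma smooth_functionN (f : M -> R) :
  smooth_function A f -> smooth_function A (fun p => - f p).
Proof.
move=> sf c Ac k; apply: (@CkN _ _ _ _ (f \o chart_inv c)).
  exact: chart_img_open.
exact: sf.
Qed.

End Charts.

(** * Unique continuation: [f] has no critical zeros *)

Section UniqueContinuation.
Context {R : realType} {n : nat} {M : topologicalType} (A : smoothStructure R n M).
Context (g : riemannianMetric A) (f lambda : M -> R) (m : R).
Context (hE : generalized_Einstein g f lambda m).

Let sf : smooth_function A f. Proof. by case: hE. Qed.

Lemma metric_unitmx (c : chart R n M) x : atlas A c -> chart_img c x -> g c x \in unitmx.
Proof. by move=> Ac Ux; apply: posdef_unitmx; exact: metric_pos. Qed.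

(** Solved for the second derivatives, the Einstein equation is linear in the 1-jet of [f], with
    continuous and hence locally bounded coefficients. *)
Lemma hessian_bound c x : atlas A c -> chart_img c x ->
  exists r C, [/\ 0 < r, 0 <= C, ball x r `<=` chart_img c &
    forall y, ball x r y -> forall i j,
      `|partial i (partial j (f \o chart_inv c)) y| <=
      C * (`|f (chart_inv c y)| + \sum_k `|partial k (f \o chart_inv c) y|)].
Proof.
case: hE => _ slambda m0 hess Ac Ux.
have oU : open (chart_img c) by exact: chart_img_open.
set U := chart_img c in Ux oU *.
pose F := f \o chart_inv c.
have uG y : U y -> g c y \in unitmx by exact: metric_unitmx.
have sG i j : Csmooth U (fun y => g c y i j) by exact: metric_smooth.
pose Ga (t : 'I_n * 'I_n * 'I_n) := christoffel (g c) t.1.1 t.1.2 t.2.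
pose T (t : 'I_n * 'I_n) y := (ricci (g c) t.1 t.2 y
  - lambda (chart_inv c y) * g c y t.1 t.2) / m.
(* One continuous function dominating all coefficients at once; near [x] it stays below
   [S x + 1]. *)
pose S y := \sum_t `|Ga t y| + \sum_t `|T t y|.
have normC h : Ck 0 U h -> Ck 0 U (fun y => `|h y|).
  by case=> ch _; split=> // y Uy; apply: continuous_comp; [exact: ch|exact: norm_continuous].
have CT t : Ck 0 U (T t).
  apply: CkM => //; last exact: Ck_cst.
  apply: CkB => //; first exact: Csmooth_ricci.
  by apply: CkM => //; [exact: slambda|exact: sG].
have CS : Ck 0 U S.
  apply: CkD => //; apply: Ck_sum => // t; apply: normC => //.
  exact: Csmooth_christoffel.
have nS : \forall y \near x, S y < S x + 1.
  by apply: (cvgr_lt _ (Ck_continuous CS Ux)); rewrite ltrDl.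
have [r /= r0 rP] := (nbhs_ballP x _).1
  (filterI (open_nbhs_nbhs (conj oU Ux)) nS).
exists r, (S x + 1); split=> //.
- by rewrite addr_ge0// addr_ge0// sumr_ge0.
- by move=> y /rP[].
move=> y /rP[Uy /ltW Sy] i j.
have GaS k : `|christoffel (g c) k i j y| <= S x + 1.
  apply: le_trans Sy; rewrite /S (bigD1 (k, i, j)) //= -!addrA lerDl.
  by rewrite addr_ge0// sumr_ge0.
have TS : `|T (i, j) y| <= S x + 1.
  apply: le_trans Sy; rewrite /S [X in _ + X](bigD1 (i, j)) //= addrCA lerDl.
  by rewrite addr_ge0// sumr_ge0.
have -> : partial i (partial j F) y =
    F y * T (i, j) y + \sum_k christoffel (g c) k i j y * partial k F y.
  have := hess c Ac y Uy i j; rewrite /hessian => /eqP.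
  rewrite subr_eq => /eqP ->; congr (_ + _).
  by rewrite /T /F /=; field; rewrite gt_eqF.
rewrite (le_trans (ler_normD _ _))// mulrDr lerD//.
  by rewrite normrM mulrC ler_wpM2r.
rewrite (le_trans (ler_norm_sum _ _ _))// mulr_sumr ler_sum// => k _.
by rewrite normrM ler_wpM2r.
Qed.

Lemma flat_near c p : atlas A c -> chart_dom c p ->
  zero_jet (f \o chart_inv c) (c p) -> \forall q \near p, f q = 0.
Proof.
move=> Ac cp jet0; have Ux := chart_img_fun cp.
have [r [C [r0 C0 rU HC]]] := hessian_bound Ac Ux.
have nb : nbhs p (c @^-1` ball (c p) r).
  by apply: (chart_fun_cont cp); exact: nbhsx_ballx.
apply: filterS2 nb (chart_dom_nbhs cp) => q rq cq.
have [] := zero_jet_ball (sf Ac 2%N) C0 rU HC rq jet0.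
by rewrite /= chart_funK.
Qed.

Lemma jet_flat (c : chart R n M) p : chart_dom c p -> (\forall q \near p, f q = 0) ->
  zero_jet (f \o chart_inv c) (c p).
Proof.
move=> cp f0; have nF := chart_near cp f0.
split; first by rewrite /= chart_funK//; exact: nbhs_singleton f0.
move=> j; rewrite /partial -(derive_cst (0 : R) (c p) 'e_j).
exact: near_eq_derive nF.
Qed.

(** A nonzero value at [c p] would persist on a neighbourhood, which meets [Z]. *)
Lemma closure_jet0 (c : chart R n M) p (Z : set M) (h : 'rV[R]_n -> R) : chart_dom c p ->
  closure Z p -> {for c p, continuous h} ->
  (forall q, Z q -> chart_dom c q -> h (c q) = 0) -> h (c p) = 0.
Proof.
move=> cp Zp ch hZ; apply/eqP; apply: contrapT => /negP h0.
have nh : \forall x \near c p, h x != 0.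
  have hn0 : 0 < `|h (c p)| by rewrite normr_gt0.
  move: ch => /cvgrPdist_lt /(_ _ hn0); apply: filterS => x.
  by apply: contraTneq => ->; rewrite subr0 ltxx.
have nc : nbhs p (c @^-1` [set x | h x != 0]) by exact: (chart_fun_cont cp).
have [q [Zq [/= hq cq]]] := Zp _ (filterI nc (chart_dom_nbhs cp)).
by rewrite hZ ?eqxx in hq.
Qed.

Lemma regular_zero (q0 : M) c p : connected [set: M] -> f q0 != 0 ->
  atlas A c -> chart_dom c p -> f p = 0 ->
  exists j, partial j (f \o chart_inv c) (c p) != 0.
Proof.
move=> cM fq0 Ac cp fp; apply: contrapT => /forallNP nj.
pose Z := interior (f @^-1` [set 0]).
have Zp : Z p.
  apply: (flat_near Ac cp); split; first by rewrite /= chart_funK.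
  by move=> j; apply: contrapT => /eqP; exact: nj.
(* A limit of points of [Z] inherits their vanishing 1-jet by continuity, and [flat_near] puts it
   back in [Z]. *)
have cZ : closed Z.
  move=> q Zq; have [d Ad dq] := atlas_cover A q.
  have Uq := chart_img_fun dq.
  have jZ q' : Z q' -> chart_dom d q' -> zero_jet (f \o chart_inv d) (d q').
    by move=> Zq' dq'; exact: jet_flat.
  apply: (flat_near Ad dq); split=> [|j].
    apply: (closure_jet0 dq Zq) => [|q' Zq' /(jZ _ Zq')[]//].
    exact: (Ck_continuous (sf Ad 0%N)).
  apply: (closure_jet0 dq Zq) => [|q' Zq' /(jZ _ Zq')[]//].
  exact: (Ck_continuous (CkS_partial j (sf Ad 1%N))).
have ZT : Z = setT.
  apply: cM; first by exists p.
    by exists Z; rewrite ?setTI//; exact: open_interior.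
  by exists Z; rewrite ?setTI.
have : Z q0 by rewrite ZT.
by move=> /nbhs_singleton /= f0; rewrite f0 eqxx in fq0.
Qed.

End UniqueContinuation.

(** * Charts having a given function as a coordinate *)

Section StraightChart.
Context {R : realType} {n : nat} {M : topologicalType} (A : smoothStructure R n M).

(** The chart is [straighten a F] after [c], which belongs to the atlas by maximality. Its image is
    made a ball so that [slice_connected] applies. *)
Lemma straight_chart (c : chart R n M) (h : M -> R) (p : M) (a : 'I_n) :
  atlas A c -> smooth_function A h -> chart_dom c p ->
  0 < partial a (h \o chart_inv c) (c p) ->
  exists (d : chart R n M) r, [/\ atlas A d, chart_dom d p,
    chart_img d = ball (d p) r & forall q, chart_dom d q -> d q 0 a = h q].
Proof.
move=> Ac sh cp dFp.
have oU : open (chart_img c) by exact: chart_img_open.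
set U := chart_img c in oU.
have Ux0 : U (c p) by exact: chart_img_fun.
pose F := h \o chart_inv c; have sF : Csmooth U F := sh c Ac.
have nF : \forall x \near c p, 0 < partial a F x.
  exact: (cvgr_gt _ (Ck_continuous (CkS_partial a (sF 1%N)) Ux0) _ dFp).
have [r0 /= r00 r0P] := (nbhs_ballP (c p) _).1
  (filterI (open_nbhs_nbhs (conj oU Ux0)) nF).
pose B := ball (c p) r0.
have rU : B `<=` U by move=> x /r0P[].
have dF x : B x -> 0 < partial a F x by move=> /r0P[].
have oB : open B by exact: ball_open.
pose Phi := straighten a F; pose Psi := unstraighten a F (c p) r0.
have PhiK x : B x -> Psi (Phi x) = x by exact: (straightenK sF rU dF).
have Bp : B (c p) by exact: ballxx.
have oPhiB : open (Phi @` B) by exact: (straighten_open sF rU dF oB).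
(* Openness of [Phi] allows shrinking [B] to a set [W] whose image is exactly a ball. *)
have [r r_gt0 rP] : exists2 r, 0 < r & ball (Phi (c p)) r `<=` Phi @` B.
  by apply: open_ball_sub => //; exists (c p).
pose W := B `&` Phi @^-1` ball (Phi (c p)) r.
have WB : W `<=` B by move=> x [].
have oW : open W.
  rewrite openE => x [Bx xr]; apply: filterI; first exact: open_nbhs_nbhs.
  have cPhi : {for x, continuous Phi} by exact: (straighten_continuous sF (rU _ Bx)).
  by apply: cPhi; apply: open_nbhs_nbhs; split=> //; exact: ball_open.
have PhiW : Phi @` W = ball (Phi (c p)) r.
  apply/seteqP; split=> [_ [x [_ ?] <-]//|y yr].
  have [x Bx xy] := rP _ yr; exists x => //; split=> //.
  by rewrite /preimage /= xy.
pose D := chart_dom c `&` c @^-1` W.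
pose df q := Phi (c q); pose di y := chart_inv c (Psi y).
have dimg : df @` D = ball (Phi (c p)) r.
  rewrite -PhiW; apply/seteqP; split=> [_ [q [cq Wq] <-]|_ [x Wx <-]].
    by exists (c q).
  have [dx cx] := chart_imgP (rU _ (WB _ Wx)).
  by exists (chart_inv c x); rewrite /df ?cx//; split=> //; rewrite /preimage /= cx.
have oD : open D by exact: chart_preimage_open.
have oI : open (df @` D) by rewrite dimg; exact: ball_open.
have dK q : D q -> di (df q) = q.
  by move=> [cq [Bq _]]; rewrite /di /df PhiK// chart_funK.
have dc q : D q -> {for q, continuous df}.
  move=> [cq Wq]; apply: continuous_comp; first exact: chart_fun_cont.
  exact: (straighten_continuous sF (chart_img_fun cq)).
have ic x : (df @` D) x -> {for x, continuous di}.
  move=> [q [cq [Bq _]] <-]; apply: continuous_comp.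
    exact: (unstraighten_continuous sF rU dF Bq).
  rewrite PhiK//; apply: chart_inv_cont; exact: chart_img_fun.
pose d := Chart oD oI dK dc ic.
have dE q : chart_dom d q -> d q 0 a = h q.
  by move=> [cq _]; rewrite /= /df /Phi straightenE eqxx /F /= chart_funK.
exists d, r; split=> //; last first.
  by split=> //; split=> //; exact: ballxx.
apply: atlas_maximal => e Ae; split=> k l.
  (* From the new chart to [e], the transition is the one from [c] to [e] composed with [Psi]. *)
  have [sce _] := atlas_compatible Ac Ae.
  pose V := c @` (chart_dom c `&` chart_dom e).
  have oV : open V by apply: chart_image_open; exact: chart_dom_open.
  have CV : Ck l (W `&` V) (fun x => transition c e x 0 k).
    by apply: Ck_subset (sce k l) => x [].
  have WVB : W `&` V `<=` B by move=> x [/WB].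
  have := Ck_unstraighten sF rU dF (openI oW oV) WVB CV.
  apply: Ck_subset => _ [q [[cq Wq] eq_] <-].
  by exists (c q) => //; split=> //; exists q.
have [_ sec] := atlas_compatible Ac Ae.
have oE : open (e @` (chart_dom e `&` D)) by exact: chart_image_open.
(* From [e] to the new chart, the [a]-th component is [h] read in [e]; the others are those of the
   transition from [e] to [c]. *)
have [ka|ka] := eqVneq k a.
  apply: (@Ck_eq _ _ _ _ (h \o chart_inv e)) => //.
    move=> _ [q [eq_ Dq] <-]; rewrite /transition /= chart_funK//.
    by rewrite ka -dE.
  by apply: Ck_subset (sh e Ae l) => _ [q [eq_ _] <-]; exact: chart_img_fun.
apply: (@Ck_eq _ _ _ _ (fun x => transition e c x 0 k)) => //.
  move=> x _; rewrite /transition /= /df /Phi straightenE.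
  by rewrite (negbTE ka).
by apply: Ck_subset (sec k l) => _ [q [eq_ [cq _]] <-]; exists q.
Qed.

(* The slice of a box is star-shaped, hence its points lie in one component of
   the level set. *)
Lemma slice_connected (d : chart R n M) r (h : M -> R) p q a :
  chart_img d = ball (d p) r ->
  (forall q, chart_dom d q -> d q 0 a = h q) ->
  chart_dom d p -> chart_dom d q -> h p = 0 -> h q = 0 ->
  connected_component (h @^-1` [set 0]) p q.
Proof.
move=> dr dh dp dq hp hq.
have /ball_rowP[r0 yr] : ball (d p) r (d q) by rewrite -dr; exact: chart_img_fun.
pose ga (t : R) := d p + t *: (d q - d p).
have gaE t j : ga t 0 j = d p 0 j + t * (d q 0 j - d p 0 j) by rewrite !mxE.
have ga_img t : 0 <= t <= 1 -> chart_img d (ga t).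
  move=> /andP[t0 t1]; rewrite dr; apply/ball_rowP; split=> // j.
  rewrite gaE opprD addrA subrr sub0r normrN normrM ger0_norm// distrC.
  by rewrite (le_lt_trans _ (yr j))// ler_piMl.
have cga : continuous ga.
  move=> t; apply: rV_continuous_at => j.
  have -> : (fun s => ga s 0 j) = (fun s => d p 0 j + s * (d q 0 j - d p 0 j)).
    by apply/funext => s; rewrite gaE.
  apply: continuousD; first exact: cst_continuous.
  by apply: continuousM; [exact: cvg_id|exact: cst_continuous].
pose P := chart_inv d \o ga.
have cP : {within `[0, 1], continuous P}.
  apply: continuous_in_subspaceT => t; rewrite inE /= in_itv /= => t01.
  apply: continuous_comp; first exact: cga.
  exact: chart_inv_cont (ga_img _ t01).
exists (P @` `[0, 1]); last first.
  exists 1; first by rewrite /= in_itv /= ler01 lexx.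
  by rewrite /P /ga /= scale1r addrC subrK chart_funK.
split.
- exists 0; first by rewrite /= in_itv /= ler01 lexx.
  by rewrite /P /ga /= scale0r addr0 chart_funK.
(* The [a]-th coordinate is affine along the segment and vanishes at both ends, so [h] vanishes
   throughout. *)
- move=> _ [t + <-]; rewrite /= in_itv /= => /ga_img/chart_imgP[dt et].
  rewrite -dh// et gaE !dh//.
  by rewrite hp hq subrr mulr0 addr0.
- by apply: connected_continuous_connected => //; exact: segment_connected.
Qed.

End StraightChart.

(** * Derivatives and second fundamental form on a slice *)

Section SliceDerivatives.
Context {R : realType} {n : nat}.
Implicit Types (U : set 'rV[R]_n) (h : 'rV[R]_n -> R).

(** For [i != a], moving along [e_i] does not leave the slice, so the increments of [h] are 0. *)
Lemma partial_slice U h (a i : 'I_n) : open U -> i != a ->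
  (forall x, U x -> x 0 a = 0 -> h x = 0) ->
  forall x, U x -> x 0 a = 0 -> partial i h x = 0.
Proof.
move=> oU ia h0 x Ux xa.
suff [_ e] : is_derive x 'e_i h 0 by exact: e.
apply: is_derive_axis => e e0.
have [r r0 rU] := open_ball_sub oU Ux.
exists r => // s sr; rewrite (h0 x)// (h0 (x + s *: 'e_i)).
- by rewrite mul0r !subr0 normr0 mulr_ge0// ltW.
- apply: rU; apply/ball_rowP; split=> // j; rewrite add_axisE opprD addrA subrr.
  by rewrite sub0r normrN; case: eqP => _; rewrite ?normr0.
- by rewrite add_axisE (eq_sym a) (negbTE ia) mulr0n addr0.
Qed.

(** Lowering the index of the normalized gradient of [x^a] gives a multiple of the covector [dx^a],
    so only the term [k = a] survives. *)
Lemma second_fundamental_formE (G : 'rV[R]_n -> 'M[R]_n) (a i j : 'I_n) x :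
  G x \in unitmx -> (G x)^T = G x ->
  second_fundamental_form G a i j x =
    (Num.sqrt (invmx (G x) a a))^-1 * christoffel G a i j x.
Proof.
move=> uG tG; set s := _^-1.
have nuE k : \sum_l G x k l * slice_normal G a x 0 l = s * (k == a)%:R.
  transitivity (s * (invmx (G x) *m G x) a k).
    rewrite !mxE mulr_sumr; apply: eq_bigr => l _.
    have -> : G x k l = G x l k by rewrite -{1}tG mxE.
    by rewrite !mxE -/s mulrCA [G x l k * _]mulrC.
  by rewrite mulVmx// !mxE eq_sym.
have sumE k : \sum_l christoffel G k i j x * G x k l * slice_normal G a x 0 l =
    christoffel G k i j x * (s * (k == a)%:R).
  by rewrite -nuE mulr_sumr; apply: eq_bigr => l _; rewrite mulrA.
rewrite /second_fundamental_form (eq_bigr _ (fun k _ => sumE k)).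
rewrite (bigD1 a) //= eqxx mulr1 mulrC big1 ?addr0// => k ka.
by rewrite (negbTE ka) !mulr0.
Qed.

End SliceDerivatives.

(** Without zeros, [f < 0] and [f <= 0] define the same set, open, closed and nonempty, hence all of
    [M]; but it misses [q]. *)
Lemma connected_zero (R : realType) (M : topologicalType) (f : M -> R) p q :
  connected [set: M] -> continuous f -> f p < 0 -> 0 < f q ->
  f @^-1` [set 0] !=set0.
Proof.
move=> cM cf fp fq; apply: contrapT => /set0P/negP/negPn/eqP f0.
have fn0 x : f x != 0.
  by apply/eqP => fx; have : (f @^-1` [set 0]) x by []; rewrite f0.
have : f @^-1` [set x | x < 0] = setT.
  apply: cM; first by exists p.
    exists (f @^-1` [set x | x < 0]); rewrite ?setTI//.
    by apply: open_comp => [x _|]; [exact: cf|exact: open_lt].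
  exists (f @^-1` [set x | x <= 0]).
    by apply: closed_comp => [x _|]; [exact: cf|exact: closed_le].
  by rewrite setTI; apply/seteqP; split=> x /=; rewrite lt_neqAle ?fn0// => /andP[].
move=> /seteqP[_ /(_ q Logic.I)] /=.
by rewrite ltNge ltW.
Qed.

(** * Components of the zero set are totally geodesic hypersurfaces *)

Theorem lemma2p3 (R : realType) (n : nat) (M : topologicalType)
  (A : smoothStructure R n M) (g : riemannianMetric A)
  (f lambda : M -> R) (m fmin fmax : R)
  (hn : (2 <= n)%N)
  (hM : closed_manifold_space M)
  (hE : generalized_Einstein g f lambda m)
  (hmin : range f fmin /\ lbound (range f) fmin)
  (hmax : range f fmax /\ ubound (range f) fmax)
  (hmin0 : fmin < 0) (hmax0 : 0 < fmax) :
  f @^-1` [set 0] !=set0 /\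
  forall p : M, (f @^-1` [set 0]) p ->
    hypersurface A (connected_component (f @^-1` [set 0]) p) /\
    totally_geodesic g (connected_component (f @^-1` [set 0]) p).
Proof.
have [_ _ cM] := hM; have [sf _ _ hess] := hE.
have [[q0 _ fq0] _] := hmin; have [[q1 _ fq1] _] := hmax.
have q0_neq0 : f q0 != 0 by rewrite fq0 lt_eqF.
split.
  apply: (connected_zero (p := q0) (q := q1)) => //; rewrite ?fq0 ?fq1//.
  exact: smooth_function_continuous sf.
move=> p0 _; set N := connected_component _ p0.
have N0 p : N p -> f p = 0 by move=> /connected_component_sub.
split=> [p Np|c a [Ac cN] p Np cp i j ia ja].
  have [c Ac cp] := atlas_cover A p.
  have [a dfa] := regular_zero hE cM q0_neq0 Ac cp (N0 _ Np).
  (* Since [straight_chart] asks for a positive derivative, [h] is [f] or [- f], with the same zero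
     set. *)
  have [h [sh h0 dh]] : exists h : M -> R, [/\ smooth_function A h,
      h @^-1` [set 0] = f @^-1` [set 0] &
      0 < partial a (h \o chart_inv c) (c p)].
    have [dfn|dfp|df0] := ltgtP (partial a (f \o chart_inv c) (c p)) 0.
    - exists (fun q => - f q); split; first exact: smooth_functionN.
        apply/seteqP; split=> q /= => [/eqP|->]; last by rewrite oppr0.
        by rewrite oppr_eq0 => /eqP.
      rewrite /partial deriveN ?oppr_gt0//.
      exact: CkS_derivable (sf c Ac 1%N) (chart_img_fun cp).
    - by exists f.
    - by rewrite df0 eqxx in dfa.
  have [d [r [Ad dp dr hd]]] := straight_chart Ac sh cp dh.
  have hN q : N q -> h q = 0.
    by move=> /N0 fq; have : (h @^-1` [set 0]) q by rewrite h0.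
  exists d, a; split=> //; split=> // q dq; rewrite hd//; split=> [/hN//|hq].
  (* Every zero in the domain of [d] is joined to [p] within the zero set, so other components do
     not enter this chart. *)
  apply: (connected_component_trans Np); rewrite -h0.
  by apply: (slice_connected dr hd dp dq _ hq); exact: hN.
have Ux := chart_img_fun cp.
have oU : open (chart_img c) by exact: chart_img_open.
have F0 x : chart_img c x -> x 0 a = 0 -> (f \o chart_inv c) x = 0.
  by move=> /chart_imgP[dx cx] xa; apply: N0; apply/cN => //; rewrite cx.
have pa : c p 0 a = 0 by apply/cN.
have dF0 k : k != a -> forall x, chart_img c x -> x 0 a = 0 ->
    partial k (f \o chart_inv c) x = 0.
  by move=> ka; exact: partial_slice F0.
(* The function [partial j f] itself vanishes on the slice, so the slice lemma applies to it in
   direction [i]. *)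
have ddF0 := partial_slice oU ia (dF0 j ja) Ux pa.
have [k dfk] := regular_zero hE cM q0_neq0 Ac cp (N0 _ Np).
(* Some partial derivative is nonzero at [c p], and those tangent to the slice vanish. *)
have dfa : partial a (f \o chart_inv c) (c p) != 0.
  by apply: contraNneq dfk => e; have [->|/dF0 ->] := eqVneq k a; rewrite ?e.
have := hess c Ac (c p) Ux i j.
rewrite /hessian ddF0 chart_funK// (N0 _ Np) !mul0r sub0r => /eqP.
rewrite oppr_eq0 (bigD1 a) //= big1 ?addr0 => [|l la]; last by rewrite dF0 ?mulr0.
rewrite mulf_eq0 (negbTE dfa) orbF => /eqP Ga.
rewrite second_fundamental_formE ?Ga ?mulr0//.
  exact: metric_unitmx Ac Ux.
exact: Defs.metric_sym.
Qed.
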